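(* Let $m,n\ge 1$ be integers and let $D=\{(q^i,B^i)\}_{i\in[n]}$ be a survey dataset with $m$ questions, $n$ rounds and answer space $X=\prod_{j=1}^m[0,M_j]$. Let $\Omega\subseteq\{-,+\}^n$ be its set of feasible orientation patterns for peaks outside the set of observed answers. Then $|\Omega|\le 2(m+1)n$.
   Context: Notation: $[n]=\{1,\dots,n\}$; $\langle\cdot,\cdot\rangle$ is the standard inner product. Survey dataset: $M_1,\dots,M_m>0$ are real numbers and $X=\prod_{j=1}^m[0,M_j]\subset\mathbb{R}^m$. For each round $i\in[n]$ there are a vector $a^i\in\mathbb{R}^m$ and a scalar $\mu^i\in\mathbb{R}$ defining the budget $B^i=\{x\in X : \langle a^i,x\rangle=\mu^i\}$, and an observed answer $q^i$. Standing assumptions: all coordinates of each $a^i$ are nonzero, $B^i$ intersects the interior of $X$, and $q^i\in B^i$. The vectors $a^i$ are part of the data. Oriented orthants and double cones: for $i\in[n]$, $$O^i_+=\{x\in X: a^i_j(x_j-q^i_j)\ge 0\ \text{for all } j\in[m]\},\qquad O^i_-=\{x\in X: a^i_j(x_j-q^i_j)\le 0\ \text{for all } j\in[m]\},$$ and $C^i=O^i_+\cup O^i_-$. Since the coordinates of $a^i$ are nonzero, $O^i_+\cap O^i_-=\{q^i\}$. For $y\in C^i$ with $y\ne q^i$, let $\sigma^i(y)\in\{+,-\}$ be the unique sign with $y\in O^i_{\sigma^i(y)}$. Feasible orientation patterns: let $Q=\{q^1,\dots,q^n\}$ and, for $y\in (X\setminus Q)\cap\bigcap_{i\in[n]}C^i$,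 let $\sigma(y)=(\sigma^i(y))_{i\in[n]}$. Then $$\Omega=\Bigl\{\sigma(y)\in\{-,+\}^n : y\in X\setminus Q,\ y\in\bigcap_{i\in[n]}C^i\Bigr\}.$$ *)

(* Defs.v *)
From HB Require Import structures.
From mathcomp Require Import all_boot all_order all_algebra.
From mathcomp Require Import all_classical all_reals.
From mathcomp Require Import topology normedtype.

Set Implicit Arguments.
Unset Strict Implicit.
Unset Printing Implicit Defensive.

Import Order.TTheory GRing.Theory Num.Theory.
Import numFieldNormedType.Exports.

Local Open Scope classical_set_scope.
Local Open Scope ring_scope.

Section Survey.
Variables (R : realType) (m n : nat).

Definition inner (u v : 'rV[R]_m) : R := \sum_j u 0 j * v 0 j.

Definition box (M : 'rV[R]_m) : set 'rV[R]_m :=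
  [set x | forall j, 0 <= x 0 j <= M 0 j].

Definition budget (M a : 'rV[R]_m) (mu : R) : set 'rV[R]_m :=
  [set x | box M x /\ inner a x = mu].

(* The interior in [budget_interior] is the topological one, in ['rV[R]_m]. *)
Record survey := Survey {
  bound : 'rV[R]_m;
  normal : 'I_n -> 'rV[R]_m;
  level : 'I_n -> R;
  answer : 'I_n -> 'rV[R]_m;
  bound_gt0 : forall j, 0 < bound 0 j;
  normal_neq0 : forall i j, normal i 0 j != 0;
  budget_interior : forall i,
    budget bound (normal i) (level i) `&` interior (box bound) !=set0;
  answer_budget : forall i, budget bound (normal i) (level i) (answer i)
}.

Variable D : survey.

Definition space : set 'rV[R]_m := box (bound D).

(* Signs are booleans: [true] stands for +, [false] for -. *)
Definition orthant (i : 'I_n) (s : bool) : set 'rV[R]_m :=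
  [set x | space x /\ forall j,
    let t := normal D i 0 j * (x 0 j - answer D i 0 j) in
    if s then 0 <= t else t <= 0].

Definition cone (i : 'I_n) : set 'rV[R]_m := orthant i true `|` orthant i false.

(* The sign of the orthant of [y]; only meaningful for [y] in [cone i] distinct
   from [answer D i], where [orthant_signP] shows that this sign is unique. *)
Definition orthant_sign (i : 'I_n) (y : 'rV[R]_m) : bool :=
  `[< orthant i true y >].

Definition orientation (y : 'rV[R]_m) : {ffun 'I_n -> bool} :=
  [ffun i => orthant_sign i y].

Definition peaks : set 'rV[R]_m :=
  (space `\` range (answer D)) `&` \bigcap_i cone i.

Definition orientation_patterns : {set {ffun 'I_n -> bool}} :=
  [set s | s \in orientation @` peaks]%SET.

Lemma orthantI i : orthant i true `&` orthant i false = [set answer D i].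
Proof.
apply/seteqP; split => [y [[_ yp] [_ yn]]|_ ->].
  apply/rowP => j; have := yp j; have := yn j => /= h1 h2.
  have /eqP : normal D i 0 j * (y 0 j - answer D i 0 j) = 0.
    by apply/eqP; rewrite eq_le h1 h2.
  by rewrite mulf_eq0 (negPf (normal_neq0 D i j)) /= subr_eq0 => /eqP.
have [qX _] := answer_budget D i.
by split; split => // j /=; rewrite subrr mulr0.
Qed.

Lemma orthant_signP i y (s : bool) : cone i y -> y <> answer D i ->
  orthant i s y <-> s = orthant_sign i y.
Proof.
move=> Cy yq; rewrite /orthant_sign.
have nI : ~ (orthant i true y /\ orthant i false y).
  by move=> h; apply: yq; have : [set answer D i] y by rewrite -orthantI.
case: s; split.
- by move=> h; apply/esym/asboolP.
- by move=> /esym/asboolP.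
- by move=> h; apply/esym/asboolPn => h'; apply: nI.
- by move=> /esym/negbT/asboolPn h; case: Cy.
Qed.

End Survey.

(* Main.v *)
Require Import Defs.
From mathcomp Require Import all_boot all_order all_algebra.
From mathcomp Require Import all_classical all_reals.

(** A coordinate [k] in which a peak [y] of the double cone at an answer [q]
    differs from [q] fixes the orientation of [y] at [q]: it is read off from
    the sign of [y 0 k - q 0 k] ([eq_orthant_sign]).  So the orientation
    pattern of [y] is known as soon as each answer is compared with [y] in one
    coordinate where the two differ.

    If [y] shared no coordinate with an answer, its rank among the answers in
    a single coordinate would do.  In general, read the coordinates of [y] in
    order and keep the answers that still agree with [y].  All answers are kept
    at the start and none at the end, because [y] is not an answer; let [j] be
    the coordinate at which the last of them are lost.  An answer lost before
    [j] differs from [y] in one of the coordinates before [j], and these are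
    the coordinates of any answer [i] kept up to [j].  Those lost at [j] differ
    from [y] in coordinate [j], where it remains only to know which of them lie
    below [y]: either none does, or they are cut off by the highest one, which
    can be chosen as [i].  Hence the pattern is a function of [j], [i] and one
    bit ([code_orientation]), and there are at most [2 * m * n] patterns. *)

Set Implicit Arguments.
Unset Strict Implicit.
Unset Printing Implicit Defensive.

Import Order.TTheory GRing.Theory Num.Theory.

Local Open Scope classical_set_scope.
Local Open Scope ring_scope.

Section OrientationCode.
Variables (R : realType) (m n : nat) (D : survey R m n).

Local Notation q := (answer D).

Lemma orthant_sign_neq i y k : cone D i y -> y 0 k != q i 0 k ->
  orthant_sign D i y = (0 < normal D i 0 k * (y 0 k - q i 0 k)).
Proof.
move=> Cy neq; have t0 : normal D i 0 k * (y 0 k - q i 0 k) != 0.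
  by rewrite mulf_neq0 ?normal_neq0 // subr_eq0.
have yq : y <> q i by move=> E; rewrite E eqxx in neq.
case: (Cy) => O; have /orthant_signP -/(_ Cy yq) <- := O; case: O => _ /(_ k) /=.
  by rewrite lt_def t0 => ->.
by rewrite leNgt => /negbTE.
Qed.

Lemma eq_orthant_sign i y z k : cone D i y -> cone D i z ->
  y 0 k != q i 0 k -> z 0 k != q i 0 k ->
  (q i 0 k < y 0 k) = (q i 0 k < z 0 k) ->
  orthant_sign D i y = orthant_sign D i z.
Proof.
move=> Cy Cz yk zk; rewrite !(orthant_sign_neq (k := k)) //.
have := normal_neq0 D i k; rewrite neq_lt => /orP[a0|a0].
  rewrite !nmulr_rgt0 // !subr_lt0 ![_ < q i 0 k]ltNge !le_eqVlt.
  by rewrite ![q i 0 k == _]eq_sym (negbTE yk) (negbTE zk) /= => ->.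
by rewrite !pmulr_rgt0 // !subr_gt0.
Qed.

Definition agree (y z : 'rV[R]_m) (j : nat) : bool :=
  [forall k : 'I_m, (k < j)%N ==> (y 0 k == z 0 k)].

Lemma agreeP {y z : 'rV[R]_m} {j : nat} :
  reflect (forall k : 'I_m, (k < j)%N -> y 0 k = z 0 k) (agree y z j).
Proof.
by apply: (iffP forall_inP) => h k kj; apply/eqP; [apply: h | rewrite h].
Qed.

Lemma agreeS y z (j : 'I_m) :
  agree y z j -> y 0 j = z 0 j -> agree y z j.+1.
Proof.
move=> /agreeP yz yzj; apply/agreeP => k; rewrite ltnS leq_eqVlt.
by case/orP => [/eqP/val_inj-> //|]; apply: yz.
Qed.

Lemma agree_full y z : agree y z m -> y = z.
Proof. by move=> /agreeP h; apply/rowP => k; apply: h. Qed.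

(** The bit [b] says whether some answer that agrees with [y] before [j] lies
    below [y] at [j]; if so, [i] is the highest such answer.  When [b] is false,
    [i] serves only to record the coordinates of [y] before [j]. *)
Definition code (y : 'rV[R]_m) (c : 'I_m * 'I_n * bool) : Prop :=
  let: (j, i, b) := c in
  [/\ agree y (q i) j,
      forall k, agree y (q k) j -> y 0 j != q k 0 j &
      forall k, agree y (q k) j ->
        (q k 0 j < y 0 j) = b && (q k 0 j <= q i 0 j)].

Lemma code_orientation y z c : peaks D y -> peaks D z ->
  code y c -> code z c -> orientation D y = orientation D z.
Proof.
move=> [_ Cy] [_ Cz]; case: c => [[j i] b] [yi yneq ylt] [zi zneq zlt].
have yz (k : 'I_m) : (k < j)%N -> y 0 k = z 0 k.
  by move=> kj; rewrite (agreeP yi) // (agreeP zi).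
apply/ffunP => k; rewrite !ffunE.
have [yk|] := boolP (agree y (q k) j).
  have zk : agree z (q k) j.
    by apply/agreeP => l lj; rewrite -yz // (agreeP yk).
  apply: (eq_orthant_sign (k := j)); [exact: Cy|exact: Cz|exact: yneq|exact: zneq|].
  by rewrite ylt // zlt.
move=> /forall_inPn[l lj yl].
by apply: (eq_orthant_sign (k := l));
  [exact: Cy|exact: Cz|exact: yl|rewrite -yz|rewrite yz].
Qed.

(** That [y] is not an answer makes [j] exist; having at least one answer
    ensures that the loss happens at some coordinate, so that some answer [i]
    agrees with [y] before [j]. *)
Lemma code_exists y : (0 < n)%N -> peaks D y -> exists c, code y c.
Proof.
move=> n0 [[_ yq] _].
have lost_m : [forall i, ~~ agree y (q i) m].
  by apply/forallP => i; apply/negP => /agree_full yi; apply: yq; exists i.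
have ex_lost : exists j, [forall i, ~~ agree y (q i) j] by exists m.
case: (ex_minnP ex_lost) => [[|j]] lost minj.
  have /negP[] := forallP lost (Ordinal n0).
  by apply/agreeP.
pose oj := Ordinal (minj _ lost_m).
have neq k : agree y (q k) oj -> y 0 oj != q k 0 oj.
  move=> yk; apply/negP => /eqP E.
  by have /negP[] := forallP lost k; apply: (agreeS (j := oj)).
have [i0 yi0] : exists i, agree y (q i) oj.
  have /forallPn[i /negPn ?] : ~~ [forall i, ~~ agree y (q i) j].
    by apply/negP => /minj; rewrite ltnn.
  by exists i.
have [/existsP[i1 below]|none] :=
  boolP [exists i, agree y (q i) oj && (q i 0 oj < y 0 oj)].
  case: (@arg_maxP _ _ _ i1 (fun i => agree y (q i) oj && (q i 0 oj < y 0 oj))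
    (fun i => q i 0 oj) below) => i /andP[yi iy] imax.
  exists (oj, i, true); split => // k yk /=.
  apply/idP/idP => [ky|ki]; first by apply: imax; rewrite yk.
  exact: le_lt_trans ki iy.
exists (oj, i0, false); split => // k yk /=; apply/negbTE.
by move/existsPn: none => /(_ k); rewrite yk.
Qed.

End OrientationCode.

Theorem lemma1 (R : realType) (m n : nat) (hm : (1 <= m)%N) (hn : (1 <= n)%N)
  (D : survey R m n) :
  (#|orientation_patterns D| <= 2 * (m + 1) * n)%N.
Proof.
pose decode (c : 'I_m * 'I_n * bool) :=
  orientation D (xget 0 [set y | peaks D y /\ code D y c]).
have sub : orientation_patterns D \subset decode @: predT.
  apply/fintype.subsetP => s; rewrite inE => /set_mem[y py <-].
  have [c yc] := code_exists hn py.
  apply/imsetP; exists c => //; rewrite /decode.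
  case: xgetP => [z _ [pz zc]|/(_ y)[]//].
  exact: code_orientation yc zc.
apply: leq_trans (subset_leq_card sub) _.
apply: leq_trans (leq_imset_card _ _) _.
rewrite !card_prod !card_ord card_bool mulnC mulnA leq_mul2r.
by rewrite leq_mul2l leq_addr !orbT.
Qed.
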